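(* Let $\mathcal X$, $\mathcal C$, $h$, $D_h$ be as in the context and let $f:\mathcal X\to\mathbb R$ be convex on $\mathcal X$ and differentiable on $\mathcal C$. Let $x_k\in\mathcal C$, $\eta_k>0$, and let $x_{k+1}\in\mathcal C$ satisfy $$x_{k+1}\in\operatorname*{argmin}_{x\in\mathcal X}\Bigl\{f(x)+\frac1{\eta_k}D_h(x,x_k)\Bigr\}.$$ Then, for every $x\in\mathcal X$ for which $D_h(x,x_k)$ is finite, $$\eta_k\bigl(f(x_{k+1})-f(x)\bigr)\le D_h(x,x_k)-D_h(x,x_{k+1})-D_h(x_{k+1},x_k).$$ In particular, $$f(x_{k+1})+\frac1{\eta_k}D_h(x_{k+1},x_k)\le f(x_k),$$ so the objective values of a sequence of such steps are nonincreasing for all choices of stepsizes $\eta_k>0$.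
   Context: $\mathcal X$ is a nonempty closed convex set in a finite-dimensional Euclidean space and $\mathcal C=\operatorname{ri}(\mathcal X)$ is its relative interior. All derivatives are taken along directions of the affine hull $\operatorname{aff}(\mathcal X)$: for $\varphi$ differentiable on $\mathcal C$, $\nabla\varphi(x)$ is the vector in the direction space of $\operatorname{aff}(\mathcal X)$ representing the derivative for the Euclidean inner product. $h:\mathcal C\to\mathbb R$ is a $C^2$ Legendre function (strictly convex, with $\|\nabla h(x_j)\|\to\infty$ whenever $x_j\in\mathcal C$ tends to a point of $\mathcal X\setminus\mathcal C$), extended continuously to those points of $\mathcal X\setminus\mathcal C$ used as comparison points. For $x\in\mathcal X$, $y\in\mathcal C$, $D_h(x,y)=h(x)-h(y)-\langle\nabla h(y),x-y\rangle$; at a boundary point $x$ this is finite when the (finite) continuous extension $h(x)$ exists, and is regarded as $+\infty$ otherwise. *)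

(* Defs.v *)
From HB Require Import structures.
From mathcomp Require Export all_boot all_order all_algebra.
From mathcomp Require Export all_classical all_reals all_analysis.
Export Order.TTheory GRing.Theory Num.Theory.
Export numFieldNormedType.Exports.

Set Implicit Arguments.
Unset Strict Implicit.
Unset Printing Implicit Defensive.

Local Open Scope classical_set_scope.
Local Open Scope ring_scope.

(* The Euclidean space is 'rV[R]_n with [dot] and [enorm].  The library norm on
   'rV[R]_n is the sup norm; it defines the same topology as [enorm]. *)
Definition dot (R : realType) (n : nat) (u v : 'rV[R]_n) : R :=
  \sum_(i < n) u 0 i * v 0 i.

Definition enorm (R : realType) (n : nat) (u : 'rV[R]_n) : R :=
  Num.sqrt (dot u u).

Definition affine_hull (R : realType) (n : nat) (X : set 'rV[R]_n) :
    set 'rV[R]_n :=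
  [set x | exists (m : nat) (a : 'I_m -> R) (p : 'I_m -> 'rV[R]_n),
    [/\ forall i, X (p i), \sum_(i < m) a i = 1
      & x = \sum_(i < m) a i *: p i]].

Definition direction (R : realType) (n : nat) (X : set 'rV[R]_n) :
    set 'rV[R]_n :=
  [set v | exists x y, [/\ affine_hull X x, affine_hull X y & v = x - y]].

Definition rel_interior (R : realType) (n : nat) (X : set 'rV[R]_n) :
    set 'rV[R]_n :=
  [set x | X x /\ \forall y \near x, affine_hull X y -> X y].

(* Frechet derivative along aff(X) at points of ri(X).  Since ri(X) is open in
   aff(X), letting y tend to x inside ri(X) or inside aff(X) is the same; the
   former only involves values of phi on ri(X). *)
Definition is_gradient (R : realType) (n : nat) (X : set 'rV[R]_n)
    (phi : 'rV[R]_n -> R) (x g : 'rV[R]_n) : Prop :=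
  direction X g /\
  forall e : R, 0 < e -> \forall y \near x, rel_interior X y ->
    `|phi y - phi x - dot g (y - x)| <= e * enorm (y - x).

Definition differentiable_ri (R : realType) (n : nat) (X : set 'rV[R]_n)
    (phi : 'rV[R]_n -> R) : Prop :=
  forall x, rel_interior X x -> exists g, is_gradient X phi x g.

Definition gradient (R : realType) (n : nat) (X : set 'rV[R]_n)
    (phi : 'rV[R]_n -> R) (x : 'rV[R]_n) : 'rV[R]_n :=
  xget 0 [set g | is_gradient X phi x g].

(* [A], restricted to the direction space, is the derivative at x of the vector
   field [G] (row vectors: the derivative along v is v *m A). *)
Definition is_jacobian (R : realType) (n : nat) (X : set 'rV[R]_n)
    (G : 'rV[R]_n -> 'rV[R]_n) (x : 'rV[R]_n) (A : 'M[R]_n) : Prop :=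
  forall e : R, 0 < e -> \forall y \near x, rel_interior X y ->
    enorm (G y - G x - (y - x) *m A) <= e * enorm (y - x).

(* Only the restriction of the Hessian to the direction space is determined, so
   its continuity is required along those directions. *)
Definition C2_ri (R : realType) (n : nat) (X : set 'rV[R]_n)
    (phi : 'rV[R]_n -> R) : Prop :=
  differentiable_ri X phi /\
  exists H : 'rV[R]_n -> 'M[R]_n,
    (forall x, rel_interior X x -> is_jacobian X (gradient X phi) x (H x)) /\
    (forall v, direction X v ->
      {within rel_interior X, continuous (fun x => v *m H x)}).

Definition strictly_convex (R : realType) (n : nat) (C : set 'rV[R]_n)
    (phi : 'rV[R]_n -> R) : Prop :=
  forall x y, C x -> C y -> x != y -> forall t : R, 0 < t < 1 ->
    phi (t *: x + (1 - t) *: y) < t * phi x + (1 - t) * phi y.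

Definition C2_Legendre (R : realType) (n : nat) (X : set 'rV[R]_n)
    (h : 'rV[R]_n -> R) : Prop :=
  [/\ C2_ri X h,
      strictly_convex (rel_interior X) h
    & forall (u : nat -> 'rV[R]_n) (z : 'rV[R]_n),
        (forall j, rel_interior X (u j)) ->
        (X `\` rel_interior X) z ->
        u @ \oo --> z ->
        (fun j => enorm (gradient X h (u j))) @ \oo --> +oo].

(* h on ri(X); at the other points of X, the continuous extension of h when it
   exists and is finite, and +oo otherwise.  Values of h off ri(X) are unused. *)
Definition extension (R : realType) (n : nat) (X : set 'rV[R]_n)
    (h : 'rV[R]_n -> R) (x : 'rV[R]_n) : \bar R :=
  if x \in rel_interior X then (h x)%:E
  else if `[< cvg (h @ within (rel_interior X) (nbhs x)) >]
    then (lim (h @ within (rel_interior X) (nbhs x)))%:E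
    else +oo%E.

Definition bregman (R : realType) (n : nat) (X : set 'rV[R]_n)
    (h : 'rV[R]_n -> R) (x y : 'rV[R]_n) : \bar R :=
  (extension X h x - (h y)%:E - (dot (gradient X h y) (x - y))%:E)%E.

Definition argmin (R : realType) (T : Type) (A : set T) (F : T -> \bar R) :
    set T :=
  [set x | A x /\ forall y, A y -> (F x <= F y)%E].

Definition bregman_prox_step (R : realType) (n : nat) (X : set 'rV[R]_n)
    (h f : 'rV[R]_n -> R) (eta : R) (x x' : 'rV[R]_n) : Prop :=
  [/\ rel_interior X x, 0 < eta, rel_interior X x'
    & argmin X (fun z => ((f z)%:E + (eta^-1)%:E * bregman X h z x)%E) x'].

(* Main.v *)
Require Import Defs.
From mathcomp Require Import ring lra.

(** The estimate is the first-order optimality condition of the step, tested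
    along a segment.  Write [p] for the new point, [q] for the old one, and let
    [x] be any comparison point of [X].  Because [p] is relatively interior, the
    points [p + t (x - p)] stay in ri(X) for small [t > 0], even when [x] is a
    boundary point ([line_rel_interior]).  Minimality of [p] against such a
    point, combined with the convexity bound
    [f (p + t (x - p)) - f p <= t (f x - f p)], gives
    [eta (f p - f x) + <grad h q, x - p> <= (h (p + t (x - p)) - h p) / t].
    The right-hand side tends to [<grad h p, x - p>] as [t] decreases to [0]
    ([gradient_cvg]), hence the variational inequality
    [eta (f p - f x) <= <grad h p - grad h q, x - p>] ([prox_step_variational]).
    The latter inner product is exactly
    [D_h(x, q) - D_h(x, p) - D_h(p, q)] ([bregman_three_points]): the value of
    [h] at [x] cancels, so only its finiteness matters.

    Comparing [p] with [q] itself, where [D_h(q, q) = 0], gives the descent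
    inequality; since a convex function lies above its tangents, [D_h >= 0]
    ([bregman_ge0]), and the objective values cannot increase. *)

Set Implicit Arguments.
Unset Strict Implicit.
Unset Printing Implicit Defensive.

Local Open Scope classical_set_scope.
Local Open Scope ring_scope.

Section Dot.
Context {R : realType} {n : nat}.
Implicit Types u v w : 'rV[R]_n.

Lemma dotDr u v w : dot u (v + w) = dot u v + dot u w.
Proof.
by rewrite /dot -big_split /=; apply: eq_bigr => i _; rewrite mxE mulrDr.
Qed.

Lemma dotZr u (a : R) v : dot u (a *: v) = a * dot u v.
Proof. by rewrite /dot mulr_sumr; apply: eq_bigr => i _; rewrite mxE mulrCA. Qed.

Lemma dotC u v : dot u v = dot v u.
Proof. by apply: eq_bigr => i _; rewrite mulrC. Qed.

Lemma dotBr u v w : dot u (v - w) = dot u v - dot u w.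
Proof. by rewrite -scaleN1r dotDr dotZr mulN1r. Qed.

Lemma dotBl u v w : dot (u - v) w = dot u w - dot v w.
Proof. by rewrite dotC dotBr !(dotC w). Qed.

Lemma enormZ (a : R) u : 0 <= a -> enorm (a *: u) = a * enorm u.
Proof.
move=> a0; rewrite /enorm dotZr dotC dotZr mulrA -expr2 sqrtrM ?sqr_ge0//.
by rewrite sqrtr_sqr ger0_norm.
Qed.

End Dot.

Section RelativeInterior.
Context {R : realType} {n : nat}.
Implicit Types (X : set 'rV[R]_n) (phi : 'rV[R]_n -> R) (p x g : 'rV[R]_n).

Lemma line_convex_comb p x (t : R) : p + t *: (x - p) = t *: x + (1 - t) *: p.
Proof. by rewrite scalerBr scalerBl scale1r addrCA. Qed.

Lemma line_affine_hull X p x (t : R) :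
  X p -> X x -> affine_hull X (p + t *: (x - p)).
Proof.
move=> Xp Xx; exists 2%N, (fun i => if i == ord0 then 1 - t else t),
  (fun i => if i == ord0 then p else x).
split.
- by move=> i; case: ifP.
- by rewrite !big_ord_recl big_ord0 /= addr0 subrK.
- rewrite !big_ord_recl big_ord0 /= addr0.
  by rewrite line_convex_comb addrC.
Qed.

Lemma line_cvg p x : p + t *: (x - p) @[t --> (0 : R)^'+] --> p.
Proof.
apply: cvg_at_right_filter.
rewrite -[X in _ --> X]addr0 -(scale0r (x - p)).
by apply: cvgD; [exact: cvg_cst | apply: cvgZr_tmp; exact: cvg_id].
Qed.

(** ri(X) is open in aff(X), and a line through two points of [X] stays in
    aff(X). *)
Lemma line_rel_interior X p x : rel_interior X p -> X x ->
  \forall t \near (0 : R)^'+, rel_interior X (p + t *: (x - p)).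
Proof.
move=> [Xp /nbhs_interior Xnear] Xx.
have near_line := line_cvg x Xnear.
near=> t.
have near_t : (fun y => affine_hull X y -> X y)° (p + t *: (x - p)).
  by near: t.
split; last exact: near_t.
have sub_t := nbhs_singleton near_t.
by apply: sub_t; exact: line_affine_hull.
Unshelve. all: by end_near. Qed.

(** Read along a segment issued from [p], the Frechet derivative becomes a
    one-sided directional derivative; the endpoint [x] may lie on the relative
    boundary. *)
Lemma gradient_cvg X phi p g x :
  rel_interior X p -> X x -> is_gradient X phi p g ->
  (phi (p + t *: (x - p)) - phi p) / t @[t --> (0 : R)^'+] --> dot g (x - p).
Proof.
move=> pri Xx [_ dphi]; apply/cvgrPdist_le => e e0.
have en0 : 0 <= enorm (x - p) by rewrite sqrtr_ge0.
(* The factor [1 + enorm] rather than [enorm] covers the case [x = p]. *)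
have d0 : 0 < e / (1 + enorm (x - p)) by rewrite divr_gt0// ltr_pwDl.
have near_dphi := line_cvg x (dphi _ d0).
near=> t.
have t0 : 0 < t by near: t; exact: nbhs_right_gt.
have zri : rel_interior X (p + t *: (x - p)).
  by near: t; exact: line_rel_interior.
have : rel_interior X (p + t *: (x - p)) ->
  `|phi (p + t *: (x - p)) - phi p - dot g (p + t *: (x - p) - p)|
    <= e / (1 + enorm (x - p)) * enorm (p + t *: (x - p) - p).
  by near: t.
have -> : p + t *: (x - p) - p = t *: (x - p) by rewrite addrAC subrr add0r.
move=> /(_ zri); rewrite dotZr (enormZ _ (ltW t0)) => le_t.
have -> : dot g (x - p) - (phi (p + t *: (x - p)) - phi p) / t =
    - (phi (p + t *: (x - p)) - phi p - t * dot g (x - p)) / t.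
  by field; rewrite gt_eqF.
rewrite normrM normrN normfV (gtr0_norm t0) ler_pdivrMr//.
apply: (le_trans le_t); rewrite mulrCA mulrC; apply: ler_wpM2r; first exact: ltW.
rewrite mulrAC ler_pdivrMr ?ltr_pwDl// ler_pM2l//.
by rewrite lerDr.
Unshelve. all: by end_near. Qed.

Lemma gradientP X phi p :
  differentiable_ri X phi -> rel_interior X p ->
  is_gradient X phi p (gradient X phi p).
Proof. by move=> dphi /dphi; exact: xgetPex. Qed.

(** Convexity bounds every difference quotient of [phi] from [p] towards [x] by
    [phi x - phi p], and the bound passes to the limit. *)
Lemma tangent_le X phi p x :
  differentiable_ri X phi -> strictly_convex (rel_interior X) phi ->
  rel_interior X p -> rel_interior X x ->
  phi p + dot (gradient X phi p) (x - p) <= phi x.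
Proof.
move=> dphi cphi pri xri.
have [->|xp] := eqVneq x p; first by rewrite dotBr subrr addr0.
have Xx : X x by case: xri.
have lim := gradient_cvg pri Xx (gradientP dphi pri).
rewrite addrC -lerBrDr; apply: (cvgr_to_le lim); near=> t.
have t0 : 0 < t by near: t; exact: nbhs_right_gt.
have t1 : t < 1 by near: t; exact: nbhs_right_lt.
rewrite ler_pdivrMr//.
have t01 : 0 < t < 1 by rewrite t0 t1.
have := cphi _ _ xri pri xp _ t01.
rewrite -line_convex_comb; nra.
Unshelve. all: by end_near. Qed.

End RelativeInterior.

Section Bregman.
Context {R : realType} {n : nat}.
Implicit Types (X : set 'rV[R]_n) (h f : 'rV[R]_n -> R) (p q x y : 'rV[R]_n).

Lemma bregman_rel_interior X h x y : rel_interior X x ->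
  bregman X h x y = (h x - h y - dot (gradient X h y) (x - y))%:E.
Proof. by move=> xri; rewrite /bregman /extension mem_set. Qed.

Lemma bregmanxx X h x : rel_interior X x -> bregman X h x x = 0%E.
Proof.
move=> xri; rewrite bregman_rel_interior// subrr.
by rewrite dotBr subrr subr0.
Qed.

Lemma bregman_ge0 X h x y :
  differentiable_ri X h -> strictly_convex (rel_interior X) h ->
  rel_interior X x -> rel_interior X y -> (0 <= bregman X h x y)%E.
Proof.
move=> dh ch xri yri; rewrite bregman_rel_interior// lee_fin.
have := tangent_le dh ch yri xri; lra.
Qed.

(** Finiteness at [(x, q)] forces the extension of [h] at [x] to be a real
    number, which then cancels between the first two terms. *)
Lemma bregman_three_points X h x p q :
  rel_interior X p -> bregman X h x q \is a fin_num ->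
  (bregman X h x q - bregman X h x p - bregman X h p q)%E =
  (dot (gradient X h p - gradient X h q) (x - p))%:E.
Proof.
move=> pri; rewrite (bregman_rel_interior h q pri) /bregman.
case: (extension X h x) => [H| |]// _; congr (_%:E).
by rewrite dotBl !dotBr; ring.
Qed.

(** The convexity bound on [f] along the segment is linear in [t], so dividing by
    [t] leaves only the difference quotient of [h] to pass to the limit. *)
Lemma prox_step_variational X h f (eta : R) q p x :
  convex_function X f -> differentiable_ri X h ->
  bregman_prox_step X h f eta q p -> X x ->
  eta * (f p - f x) <= dot (gradient X h p - gradient X h q) (x - p).
Proof.
move=> cf dh [qri eta0 pri [Xp pmin]] Xx.
have lim := gradient_cvg pri Xx (gradientP dh pri).
rewrite dotBl lerBrDr; apply: (cvgr_to_ge lim); near=> t.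
have t0 : 0 < t by near: t; exact: nbhs_right_gt.
have t1 : t <= 1 by near: t; exact: nbhs_right_ltW.
have zri : rel_interior X (p + t *: (x - p)).
  by near: t; exact: line_rel_interior.
rewrite ler_pdivlMr//.
have fz : f (p + t *: (x - p)) <= t * f x + (1 - t) * f p.
  rewrite line_convex_comb.
  exact: (cf (Itv01 (ltW t0) t1) x p (mem_set Xx) (mem_set Xp)).
have := pmin _ zri.1.
rewrite !bregman_rel_interior// lee_fin.
rewrite -(ler_pM2l eta0) !mulrDr !mulrA divff ?gt_eqF// !mul1r.
have := fz; rewrite -(ler_pM2l eta0).
rewrite !(dotBr, dotDr, dotZr); nra.
Unshelve. all: by end_near. Qed.

Lemma prox_step_descent X h f (eta : R) q p :
  bregman_prox_step X h f eta q p ->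
  ((f p)%:E + (eta^-1)%:E * bregman X h p q <= (f q)%:E)%E.
Proof.
move=> [qri _ _ [_ pmin]].
by have := pmin q qri.1; rewrite (bregmanxx h qri) mule0 adde0.
Qed.

End Bregman.

Theorem proposition7p1 (R : realType) (n : nat) (X : set 'rV[R]_n)
    (h f : 'rV[R]_n -> R)
    (X_nonempty : X !=set0) (X_closed : closed X) (X_convex : convex_set X)
    (h_Legendre : C2_Legendre X h)
    (f_convex : convex_function X f)
    (f_differentiable : differentiable_ri X f) :
  (forall (eta : R) (xk xk1 : 'rV[R]_n),
     bregman_prox_step X h f eta xk xk1 ->
     (forall x, X x -> bregman X h x xk \is a fin_num ->
        ((eta * (f xk1 - f x))%:E <=
           bregman X h x xk - bregman X h x xk1 - bregman X h xk1 xk)%E) /\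
     ((f xk1)%:E + (eta^-1)%:E * bregman X h xk1 xk <= (f xk)%:E)%E) /\
  (forall (eta : nat -> R) (x : nat -> 'rV[R]_n),
     (forall k, bregman_prox_step X h f (eta k) (x k) (x k.+1)) ->
     nonincreasing_seq (fun k => f (x k))).
Proof.
have [[dh _] ch _] := h_Legendre.
split=> [eta xk xk1 step|eta x steps].
  split=> [x Xx finD|]; last exact: prox_step_descent.
  have [_ _ xk1ri _] := step.
  by rewrite bregman_three_points// lee_fin; exact: prox_step_variational step Xx.
apply/nonincreasing_seqP => k; rewrite -lee_fin.
apply: le_trans (prox_step_descent (steps k)).
have [xri eta0 x1ri _] := steps k.
rewrite leeDl// mule_ge0//; first by rewrite lee_fin invr_ge0 ltW.
exact: bregman_ge0.
Qed.
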